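(* Let $(\mathfrak{A},* )$ be a polarizable $*$-algebra. Then there is an element $\kappa\in\mathfrak{A}$ (depending only on $(\mathfrak{A},* )$) such that for every left $\mathfrak{A}$-module $\mathsf{X}$, every Hermitian form $Q:\mathsf{X}\times\mathsf{X}\to\mathfrak{A}$, and every polarizing subgroup $G\subset\Gamma(\mathfrak{A},* )$, we have $$Q(x,y)=\kappa\int_G q(x+gy)\,g\,dg\qquad\text{for all }x,y\in\mathsf{X},$$ where $q(x)=Q(x,x)$ and the integral is that of an $\mathfrak{A}$-valued function on $G$ with respect to the normalized Haar measure.
   Context: A $*$-algebra $(\mathfrak{A},* )$ is a finite-dimensional unital associative algebra over $\mathbb{R}$ equipped with an $\mathbb{R}$-linear map (involution) $\alpha\mapsto\alpha^*$ satisfying $(\alpha\beta)^*=\beta^*\alpha^*$ and $(\alpha^* )^*=\alpha$. It carries its natural topology as a finite-dimensional real vector space, and subsets carry the subspace topology. Its unitary group is $\Gamma(\mathfrak{A},* )=\{u\in\mathfrak{A}: uu^*=1_{\mathfrak{A}}\}$. A closed subgroup $G\subset\Gamma(\mathfrak{A},* )$ generates $\mathfrak{A}$ if $\mathfrak{A}$ is the smallest $*$-subalgebra of $\mathfrak{A}$ containing $G$ (equivalently, $\mathrm{span}_{\mathbb{R}}G=\mathfrak{A}$). $(\mathfrak{A},* )$ is polarizable if $\Gamma(\mathfrak{A},* )$ is compact and generates $\mathfrak{A}$. Haar measure on a compact group is always normalized to be a probability measure, and integrals of functions with values in a finite-dimensional real vector space are defined coordinatewise. A compact subgroup $G\subset\Gamma(\mathfrak{A},*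 )$ is polarizing if $G$ generates $\mathfrak{A}$ and $\int_G g\,dg=0$. A Hermitian form on a left $\mathfrak{A}$-module $\mathsf{X}$ is a map $Q:\mathsf{X}\times\mathsf{X}\to\mathfrak{A}$ with $Q(x+y,z)=Q(x,z)+Q(y,z)$, $Q(\alpha x,y)=\alpha Q(x,y)$ and $Q(x,y)^*=Q(y,x)$ for all $x,y,z\in\mathsf{X}$, $\alpha\in\mathfrak{A}$. *)

(* Defs.v *)
From HB Require Import structures.
From mathcomp Require Import all_boot all_order all_algebra all_field.
From mathcomp Require Import all_classical all_reals all_analysis.

Set Implicit Arguments.
Unset Strict Implicit.
Unset Printing Implicit Defensive.

Import Order.TTheory GRing.Theory Num.Theory.
Import numFieldNormedType.Exports.

Local Open Scope classical_set_scope.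
Local Open Scope ring_scope.

Definition coordinates (R : realType) (V : vectType R) :
    V -> 'rV[R]_(\dim {:V}) :=
  passmx.rVof (vbasis {:V}).

(* V with its natural topology, transported from R^(dim V) along coordinates in
   a basis; it does not depend on the basis. *)
Definition fdim_space (R : realType) (V : vectType R) : Type :=
  initial_topology (@coordinates R V).

HB.instance Definition _ (R : realType) (V : vectType R) :=
  Topological.copy (fdim_space V) (initial_topology (@coordinates R V)).
HB.instance Definition _ (R : realType) (V : vectType R) :=
  isPointed.Build (fdim_space V) (0 : V).

Definition fdim_borel (R : realType) (V : vectType R) : Type :=
  g_sigma_algebraType (@open (fdim_space V)).

Definition fdim_integral (R : realType) (V : vectType R)
    (mu : probability (fdim_borel V) R) (D : set V) (f : V -> V) : V :=
  passmx.vecof (vbasis {:V})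
    (\row_j \int[mu]_(x in D) coordinates (f x) 0 j).

Definition involution (R : realType) (A : falgType R) (star : A -> A) : Prop :=
  [/\ linear star,
      forall a b : A, star (a * b) = star b * star a
    & involutive star].

Definition unitary_group (R : realType) (A : falgType R) (star : A -> A) :
    set A :=
  [set u | u * star u = 1].

(* In a falgType, _^-1 is the genuine inverse on invertible elements, which
   include every u with u * star u = 1 (so that u^-1 = star u). *)
Definition unitary_subgroup (R : realType) (A : falgType R) (star : A -> A)
    (G : set A) : Prop :=
  [/\ G `<=` unitary_group star,
      G 1,
      forall u v : A, G u -> G v -> G (u * v)
    & forall u : A, G u -> G u^-1].

(* {aspace A} allows subalgebras with a unit other than 1, whence 1 \in B. *)
Definition generates (R : realType) (A : falgType R) (star : A -> A)
    (G : set A) : Prop :=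
  forall B : {aspace A},
    1 \in B -> (forall a : A, a \in B -> star a \in B) ->
    (forall g : A, G g -> g \in B) ->
    forall a : A, a \in B.

Definition polarizable (R : realType) (A : falgType R) (star : A -> A) : Prop :=
  compact (unitary_group star : set (fdim_space A)) /\
  generates star (unitary_group star).

(* The normalized Haar measure of G, viewed as a Borel measure on the whole of
   A that is concentrated on G. *)
Definition haar_probability (R : realType) (A : falgType R) (G : set A)
    (mu : probability (fdim_borel A) R) : Prop :=
  mu G = 1%E /\
  forall (g : A) (B : set (fdim_borel A)),
    G g -> measurable B -> B `<=` G -> mu [set g * x | x in B] = mu B.

(* mu is meant to be the normalized Haar measure of G. *)
Definition polarizing (R : realType) (A : falgType R) (star : A -> A)
    (G : set A) (mu : probability (fdim_borel A) R) : Prop :=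
  [/\ unitary_subgroup star G,
      compact (G : set (fdim_space A)),
      generates star G
    & fdim_integral mu G (fun g : A => g) = 0].

Definition hermitian_form (R : realType) (A : falgType R) (star : A -> A)
    (X : lmodType A) (Q : X -> X -> A) : Prop :=
  [/\ forall x y z : X, Q (x + y) z = Q x z + Q y z,
      forall (a : A) (x y : X), Q (a *: x) y = a * Q x y
    & forall x y : X, star (Q x y) = Q y x].

(* Main.v *)
Require Import Defs.
From HB Require Import structures.
From mathcomp Require Import all_boot all_order all_algebra all_field.
From mathcomp Require Import all_classical all_reals all_analysis.
From mathcomp Require Import measurable_realfun.

Set Implicit Arguments.
Unset Strict Implicit.
Unset Printing Implicit Defensive.

Import Order.TTheory GRing.Theory Num.Theory.
Import numFieldNormedType.Exports.

Local Open Scope classical_set_scope.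
Local Open Scope ring_scope.

(** Write [a^*] for [star a].  On [G] one has [g^* * g = 1], so expanding
    [Q (x + g y) (x + g y) * g] gives
    [Q x x * g + g * Q y y + Q x y * g^* * g + g * (Q x y)^* * g].
    The first two terms integrate to zero because the integral of [g] vanishes,
    the third is [Q x y], and the last one integrates to [T (Q x y)], where
    [T a] denotes the integral of [g * a^* * g].  Invariance of the Haar measure
    under left and right translations gives [T (h * a) = h * T a] and
    [T (a * h) = T a * h] for [h] in [G], and since [G] spans the algebra,
    [T a = a * tau = tau * a] with [tau = T 1], the integral of [g ^+ 2].
    Hence the integral of the statement is [(1 + tau) * Q x y], and it remains
    to see that [1 + tau] has a left inverse [kappa] and that [tau] is the same
    for all polarizing subgroups.

    Independence of the subgroup ([twisted_mean1_unique]): integrate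
    [g * h * g * h] over [g] in [G] and [h] in [G'].  The integral over [h]
    alone is [g * T' (g^* ) = g * g^* * tau' = tau'], the integral over [g] alone
    is [T (h^* ) * h = tau * h^* * h = tau].

    Invertibility ([one_plus_twisted_mean_regular]): averaging a scalar product
    over the translations by [G] on both sides gives one, [form], for which
    multiplication by [a^*] is the adjoint of multiplication by [a] on either
    side.  If [z * (1 + tau) = 0], then [T z = - z], and this makes the integral
    over [G] of the squared norm of [phi g = g * z^* + z * g^*] vanish.  As [phi]
    is linear and [G] spans, it vanishes identically, in particular
    [phi z = 2 z * z^* = 0], so [z = 0].

    Every integrand above is linear or quadratic in [g].  The measure therefore
    enters only through the matrix [moments] of the integrals of products of two
    coordinates: the integral of [b g g] for a bilinear [b] is the finite sum
    [mean moments b], the exchange of two integrals is the exchange of two finite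
    sums, and invariance under inversion and right translations follows from
    invariance under left translations by algebra. *)

(** * Means of bilinear maps *)

Local Notation bilinear := (bilinear_for *:%R *:%R).

Lemma linear_comb (R : nzRingType) (V W : lmodType R) (f : V -> W) n
    (a : 'I_n -> R) (x : 'I_n -> V) :
  linear f -> f (\sum_i a i *: x i) = \sum_i a i *: f (x i).
Proof.
move=> fl; pose fL := GRing.isLinear.Build _ _ _ _ f fl.
pose F : {linear V -> W} := HB.pack f fL.
by rewrite -[f]/(F : V -> W) linear_sum; apply: eq_bigr => i _; rewrite linearZ.
Qed.

Lemma linear_at0 (R : nzRingType) (V W : lmodType R) (f : V -> W) :
  linear f -> f 0 = 0.
Proof.
by move=> fl; have := fl (-1) 0 0; rewrite scaler0 addr0 scaleN1r addNr.
Qed.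

Lemma linear_opp (R : nzRingType) (V W : lmodType R) (f : V -> W) x :
  linear f -> f (- x) = - f x.
Proof.
by move=> fl; have := fl (-1) x 0; rewrite (linear_at0 fl) !addr0 !scaleN1r.
Qed.

Section Mean.
Variables (R : fieldType) (A : vectType R).
Implicit Types m : 'M[R]_(\dim {:A}).

(** The integral of [b g g] with respect to a measure whose second moments in
    the basis [vbasis {:A}] are the entries of [m]. *)
Definition mean m (V : lmodType R) (b : A -> A -> V) : V :=
  \sum_i \sum_j m i j *: b (vbasis {:A})`_i (vbasis {:A})`_j.

Lemma eq_mean m (V : lmodType R) (b c : A -> A -> V) :
  b =2 c -> mean m b = mean m c.
Proof. by move=> bc; apply: eq_bigr => i _; apply: eq_bigr => j _; rewrite bc. Qed.

Lemma linear_mean m (V W : lmodType R) (f : V -> W) (b : A -> A -> V) :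
  linear f -> f (mean m b) = mean m (fun u v => f (b u v)).
Proof.
move=> fl; transitivity (\sum_i 1 *: f (\sum_j
    m i j *: b (vbasis {:A})`_i (vbasis {:A})`_j)).
  by rewrite -(linear_comb _ _ fl); congr f; apply: eq_bigr => i _; rewrite scale1r.
by apply: eq_bigr => i _; rewrite scale1r (linear_comb _ _ fl).
Qed.

Lemma meanD m (V : lmodType R) (b c : A -> A -> V) :
  mean m (fun u v => b u v + c u v) = mean m b + mean m c.
Proof.
rewrite /mean -big_split; apply: eq_bigr => i _; rewrite -big_split.
by apply: eq_bigr => j _; rewrite scalerDr.
Qed.

Lemma meanZ m (V : lmodType R) a (b : A -> A -> V) :
  mean m (fun u v => a *: b u v) = a *: mean m b.
Proof.
rewrite /mean scaler_sumr; apply: eq_bigr => i _; rewrite scaler_sumr.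
by apply: eq_bigr => j _; rewrite scalerA mulrC -scalerA.
Qed.

Lemma mean_sum m (V : lmodType R) n (b : 'I_n -> A -> A -> V) :
  mean m (fun u v => \sum_k b k u v) = \sum_k mean m (b k).
Proof.
rewrite /mean [RHS]exchange_big; apply: eq_bigr => i _.
by rewrite [RHS]exchange_big; apply: eq_bigr => j _; rewrite scaler_sumr.
Qed.

(** The form taken by the theorem of Fubini for integrands that are quadratic in
    each of the two variables. *)
Lemma mean_swap m m' (V : lmodType R) (b : A -> A -> A -> A -> V) :
  mean m (fun u v => mean m' (b u v)) =
  mean m' (fun p q => mean m (fun u v => b u v p q)).
Proof.
rewrite /mean; under eq_bigr => i _.
  under eq_bigr => j _.
    rewrite scaler_sumr; under eq_bigr => k _ do rewrite scaler_sumr.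
    over.
  rewrite exchange_big; under eq_bigr => k _ do rewrite exchange_big.
  over.
rewrite exchange_big; apply: eq_bigr => k _.
rewrite exchange_big; apply: eq_bigr => l _.
rewrite scaler_sumr; apply: eq_bigr => i _.
rewrite scaler_sumr; apply: eq_bigr => j _.
by rewrite !scalerA mulrC.
Qed.

Lemma bilinear_mean m (V : lmodType R) (b : A -> A -> A -> A -> V) :
  (forall p q, bilinear (fun u v => b u v p q)) ->
  bilinear (fun u v => mean m (b u v)).
Proof.
by move=> bb; split=> w a x y; rewrite /= -meanZ -meanD; apply: eq_mean => p q;
  [rewrite (bb p q).1|rewrite (bb p q).2].
Qed.

Lemma bilinear_comp (V W : lmodType R) (f : V -> W) (b : A -> A -> V) :
  linear f -> bilinear b -> bilinear (fun u v => f (b u v)).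
Proof.
by move=> fl [b1 b2]; split=> w a x y /=; rewrite ?b1 ?b2 fl.
Qed.

Lemma bilinear_precomp (V : lmodType R) (f g : A -> A) (b : A -> A -> V) :
  linear f -> linear g -> bilinear b -> bilinear (fun u v => b (f u) (g v)).
Proof.
by move=> fl gl [b1 b2]; split=> w a x y /=; rewrite ?fl ?gl ?b1 ?b2.
Qed.

Lemma bilinear_expand (V : lmodType R) (b : A -> A -> V) u v :
  bilinear b ->
  b u v = \sum_i \sum_j (coord (vbasis {:A}) i u * coord (vbasis {:A}) j v) *:
             b (vbasis {:A})`_i (vbasis {:A})`_j.
Proof.
move=> bb; rewrite {1}(coord_vbasis (memvf u)) (linear_comb _ _ (bb.1 v)).
apply: eq_bigr => i _; rewrite {1}(coord_vbasis (memvf v)) (linear_comb _ _ (bb.2 _)).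
by rewrite scaler_sumr; apply: eq_bigr => j _; rewrite scalerA.
Qed.
End Mean.

(** What the proof needs from the normalized Haar measure of [G], stated for its
    matrix [m] of second moments and for scalar bilinear maps only. *)
Record haar_moments (R : realType) (A : falgType R) (G : set A)
    (m : 'M[R]_(\dim {:A})) : Prop := HaarMoments {
  haar_moments_inv : forall (k : A) (b : A -> A -> R^o), G k -> bilinear b ->
    mean m (fun u v => b (k * u) (k * v)) = mean m b;
  haar_moments_cst : forall (b : A -> A -> R^o) c, bilinear b ->
    (forall g, G g -> b g g = c) -> mean m b = c;
  haar_moments_gt0 : forall b : A -> A -> R^o, bilinear b ->
    (forall g, G g -> 0 < (b g g : R)) -> 0 < (mean m b : R) }.

(** * Unitary subgroups and their linear span *)

Section StarAlgebra.
Variables (R : realType) (A : falgType R).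

Lemma scale_mull (a : R) (x y : A) : (a *: x) * y = a *: (x * y).
Proof. by rewrite scalerAl. Qed.

Lemma scale_mulr (a : R) (x y : A) : x * (a *: y) = a *: (x * y).
Proof. by rewrite scalerAr. Qed.

Lemma linear_mull (a : A) : linear ( *%R a).
Proof. by move=> c x y /=; rewrite mulrDr scale_mulr. Qed.

Lemma linear_mulr (a : A) : linear (fun x => x * a).
Proof. by move=> c x y /=; rewrite mulrDl scale_mull. Qed.

(** Right multiplication by [u] is an injective endomorphism of a
    finite-dimensional space, hence it reaches [1]. *)
Lemma regular_left_inverse (u : A) :
  (forall x, x * u = 0 -> x = 0) -> exists w, w * u = 1.
Proof.
move=> u_reg; have ker0 : lker (amulr u) == 0%VS.
  rewrite -subv0; apply/subvP => x; rewrite memv_ker memv0 lfunE /= => /eqP xu0.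
  exact/eqP/u_reg.
exists ((amulr u)^-1%VF 1); have := lker0_lfunVK ker0 1.
by rewrite lfunE.
Qed.

Lemma mul1_comm (u v : A) : u * v = 1 -> v * u = 1.
Proof.
move=> uv1; have [w wu1] : exists w, w * u = 1.
  by apply: regular_left_inverse => x xu0; rewrite -[x]mulr1 -uv1 mulrA xu0 mul0r.
by rewrite -[v in LHS]mul1r -{1}wu1 -(mulrA w) uv1 mulr1.
Qed.

Variables (star : A -> A) (star_inv : involution star).

Let star_lin : linear star. Proof. by case: star_inv. Qed.

Let starM a b : star (a * b) = star b * star a.
Proof. by case: star_inv. Qed.

Let starK : involutive star. Proof. by case: star_inv. Qed.

Let starD a b : star (a + b) = star a + star b.
Proof. by have := star_lin 1 a b; rewrite !scale1r. Qed.

Let starZ c a : star (c *: a) = c *: star a.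
Proof.
have star0 : star 0 = 0 by have := starD 0 0; rewrite addr0 -[LHS]addr0 => /addrI.
by have := star_lin c a 0; rewrite star0 !addr0.
Qed.

Let linE := (mulrDl, mulrDr, scale_mull, scale_mulr, starD, starZ).

Let star1 : star 1 = 1.
Proof. by rewrite -[LHS]mulr1 -{2}[1]starK -starM mulr1 starK. Qed.

Section Subgroup.
Variable G : set A.
Hypothesis G_sub : unitary_subgroup star G.

Lemma unitary_mul_star g : G g -> g * star g = 1.
Proof. by case: G_sub => GU _ _ _ /GU. Qed.

Lemma unitary_star_mul g : G g -> star g * g = 1.
Proof. by move=> Gg; apply/mul1_comm/unitary_mul_star. Qed.

Lemma subgroup_star g : G g -> G (star g).
Proof.
move=> Gg; case: G_sub => _ _ _ GV; suff -> : star g = g^-1 by exact: GV.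
have ug : g \is a GRing.unit.
  by apply/unitrP; exists (star g); rewrite unitary_mul_star ?unitary_star_mul.
by rewrite -[LHS]mul1r -(mulVr ug) -mulrA unitary_mul_star ?mulr1.
Qed.

(** The span of a subgroup is already a star-subalgebra, so nothing smaller than
    the whole algebra contains the generated one.  A finite spanning family
    inside [G] is obtained by maximizing the dimension of its span. *)
Lemma generates_span : generates star G ->
  exists2 s : seq A, (forall x, x \in s -> G x) & span s = fullv.
Proof.
move=> Ggen.
pose P := [pred n | `[< exists2 s : seq A,
  (forall x, x \in s -> G x) & \dim (span s) = n >]].
have exP : exists n, P n.
  by exists (\dim (span [::] : {vspace A})); apply/asboolP; exists [::].
have ubP n : P n -> (n <= \dim {:A})%N.
  by move=> /asboolP[s _ <-]; apply/dimvS/subvf.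
case: (ex_maxnP exP ubP) => n /asboolP[s sG sn] nmax.
exists s => //.
have Gs g : G g -> g \in span s.
  move=> Gg; have sub : (span s <= span (g :: s))%VS by rewrite span_cons addvSr.
  suff /eqP -> : span s == span (g :: s) by rewrite memv_span ?mem_head.
  rewrite eqEdim sub sn nmax //; apply/asboolP; exists (g :: s) => // x.
  by rewrite inE => /predU1P[->|/sG].
have s1 : 1 \in span s by apply: Gs; case: G_sub.
have sA : is_aspace (span s).
  rewrite /is_aspace has_algid1 //=; apply/prodvP => a b as_ bs.
  rewrite (coord_span (X := in_tuple s) as_) (coord_span (X := in_tuple s) bs).
  rewrite mulr_suml rpred_sum// => i _; rewrite mulr_sumr rpred_sum// => j _.
  rewrite scale_mull scale_mulr !rpredZ//; apply: Gs.
  by case: G_sub => _ _ GM _; apply: GM; apply/sG/mem_nth.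
apply/vspaceP => x; rewrite memvf.
apply: (Ggen (ASpace sA)) => //= a as_.
rewrite (coord_span (X := in_tuple s) as_) (linear_comb _ _ star_lin).
rewrite rpred_sum// => i _; rewrite rpredZ//; apply: Gs; apply: subgroup_star.
exact/sG/mem_nth.
Qed.

Lemma eq_linear_on_group (V : lmodType R) (f h : A -> V) :
  generates star G -> linear f -> linear h -> {in G, f =1 h} -> f =1 h.
Proof.
move=> /generates_span[s sG s_full] fl hl fh x.
have xs : x \in span (in_tuple s) by rewrite s_full memvf.
rewrite (coord_span xs) (linear_comb _ _ fl) (linear_comb _ _ hl).
by apply: eq_bigr => i _; rewrite fh// inE; apply/sG/mem_nth.
Qed.

(** * Invariance of means over a unitary subgroup *)

Section Moments.
Variable m : 'M[R]_(\dim {:A}).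
Hypothesis Hm : haar_moments G m.

Lemma mean_shiftl (V : vectType R) (k : A) (b : A -> A -> V) :
  G k -> bilinear b -> mean m (fun u v => b (k * u) (k * v)) = mean m b.
Proof.
move=> Gk bb; apply: (can_inj (passmx.rVofK (vbasisP fullv))).
apply/rowP => i; rewrite !mxE.
have cl : linear (coord (vbasis {:V}) i : V -> R^o) by exact: linearP.
rewrite !(linear_mean _ _ cl).
by rewrite (haar_moments_inv Hm Gk (bilinear_comp cl bb)).
Qed.

Lemma mean_cst (V : vectType R) (b : A -> A -> V) c :
  bilinear b -> (forall g, G g -> b g g = c) -> mean m b = c.
Proof.
move=> bb bc; apply: (can_inj (passmx.rVofK (vbasisP fullv))).
apply/rowP => i; rewrite !mxE.
have cl : linear (coord (vbasis {:V}) i : V -> R^o) by exact: linearP.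
rewrite !(linear_mean _ _ cl); apply: (haar_moments_cst Hm).
  exact: bilinear_comp.
by move=> g /bc ->.
Qed.

(** On [G] the involution is the inversion.  A left-invariant mean [m] is
    compared with its image [m'] under inversion, which is right-invariant, by
    averaging [b (p * q) (p * q)] over both: integrating first over [q] with [m]
    gives the [m]-mean of [b], integrating first over [p] with [m'] gives its
    [m']-mean. *)
Lemma mean_star (V : vectType R) (b : A -> A -> V) :
  bilinear b -> mean m (fun u v => b (star u) (star v)) = mean m b.
Proof.
move=> bb.
have lstarM p : linear (fun u => star u * p) by move=> c x y; rewrite !linE.
transitivity (mean m (fun p q => mean m (fun u v => b (star u * p) (star v * q)))).
  apply/esym/mean_cst.
    apply: bilinear_mean => u v.
    exact: (bilinear_precomp (linear_mull _) (linear_mull _) bb).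
  move=> g Gg; transitivity (mean m (fun u v =>
      b (star (star g * u)) (star (star g * v)))).
    by apply: eq_mean => u v; rewrite !starM !starK.
  exact: (mean_shiftl (subgroup_star Gg) (bilinear_precomp star_lin star_lin bb)).
rewrite mean_swap; apply: mean_cst.
  by apply: bilinear_mean => p q; exact: (bilinear_precomp (lstarM _) (lstarM _) bb).
by move=> g Gg; exact: (mean_shiftl (subgroup_star Gg) bb).
Qed.

Lemma mean_shiftr (V : vectType R) (k : A) (b : A -> A -> V) :
  G k -> bilinear b -> mean m (fun u v => b (u * k) (v * k)) = mean m b.
Proof.
move=> Gk bb; have bs := bilinear_precomp star_lin star_lin bb.
rewrite -(mean_star bb) -(mean_shiftl (subgroup_star Gk) bs).
rewrite -(mean_star (bilinear_precomp (linear_mulr k) (linear_mulr k) bb)).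
by apply: eq_mean => u v; rewrite !starM starK.
Qed.

(** * The twisted mean *)

(** The mean of [g * star a * g] over [G]; for [a = 1] it is the mean of
    [g ^+ 2], the analogue of the Frobenius-Schur indicator. *)
Definition twisted_mean (a : A) : A := mean m (fun u v => u * star a * v).
Local Notation tau := (twisted_mean 1).

Let bilinear_mul3 (y : A) : bilinear (fun u v : A => u * y * v).
Proof. by split=> w c u v /=; rewrite !linE. Qed.

Lemma linear_twisted_mean : linear twisted_mean.
Proof.
move=> c x y; rewrite /twisted_mean -meanZ -meanD; apply: eq_mean => u v.
by rewrite !linE.
Qed.

Hypothesis Ggen : generates star G.

Lemma twisted_mean_mulr a : twisted_mean a = a * tau.
Proof.
apply: (eq_linear_on_group Ggen linear_twisted_mean (linear_mulr _)) => g.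
rewrite inE => Gg; rewrite /twisted_mean (linear_mean _ _ (linear_mull g)).
rewrite -(mean_shiftl Gg (bilinear_mul3 (star g))); apply: eq_mean => u v.
by rewrite star1 mulr1 -!mulrA (mulrA (star g)) unitary_star_mul// mul1r.
Qed.

Lemma twisted_mean_mull a : twisted_mean a = tau * a.
Proof.
apply: (eq_linear_on_group Ggen linear_twisted_mean (linear_mull _)) => g.
rewrite inE => Gg; rewrite /twisted_mean (linear_mean _ _ (linear_mulr g)).
rewrite -(mean_shiftr Gg (bilinear_mul3 (star g))); apply: eq_mean => u v.
by rewrite star1 mulr1 -(mulrA u g) unitary_mul_star// mulr1 !mulrA.
Qed.

(** * Injectivity of multiplication by 1 + tau *)

Let dot (x y : A) : R^o :=
  \sum_i coord (vbasis {:A}) i x * coord (vbasis {:A}) i y.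

Let bilinear_dot : bilinear dot.
Proof.
split=> w c x y /=; rewrite /dot scaler_sumr -big_split; apply: eq_bigr => i _ /=.
  by rewrite linearP mulrDl scalerAl.
by rewrite linearP mulrDr scalerAr.
Qed.

Let dot_gt0 x : x != 0 -> 0 < (dot x x : R).
Proof.
move=> x0; have dot_ge0 i : 0 <= coord (vbasis {:A}) i x * coord (vbasis {:A}) i x.
  by rewrite -expr2 sqr_ge0.
rewrite lt_neqAle sumr_ge0 ?andbT//.
apply: contraNneq x0 => /esym/eqP; rewrite psumr_eq0// => /allP x_0.
rewrite (coord_vbasis (memvf x)) big1// => i _.
by have := x_0 i (mem_index_enum i); rewrite mulf_eq0 orbb => /eqP ->; rewrite scale0r.
Qed.

(** Averaging [dot (p * x * u) (p * y * u)] over [p] and [u] in [G] makes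
    multiplications by elements of [G], on either side, orthogonal, so that
    [star g] is adjoint to [g]; both sides of the adjunction are linear in [g],
    hence it extends to the whole algebra. *)
Lemma exists_invariant_form : exists form : A -> A -> R^o,
  [/\ bilinear form,
      forall a x y, form (a * x) y = form x (star a * y),
      forall a x y, form (x * a) y = form x (y * star a)
    & forall x, x != 0 -> 0 < (form x x : R)].
Proof.
pose inner x y u v := mean m (fun p q => dot (p * x * u) (q * y * v)).
pose form x y := mean m (inner x y).
have lmulmul (a b : A) : linear (fun u => u * a * b).
  by move=> c u v; rewrite !linE.
have lmulmulC (a b : A) : linear (fun u => a * b * u).
  by move=> c u v; rewrite !linE.
have lmulmid (a b : A) : linear (fun u => a * u * b).
  by move=> c u v; rewrite !linE.
have binner_pq x y u v : bilinear (fun p q => dot (p * x * u) (q * y * v)).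
  exact: (bilinear_precomp (lmulmul _ _) (lmulmul _ _)).
have binner x y : bilinear (inner x y).
  by apply: bilinear_mean => p q;
    exact: (bilinear_precomp (lmulmulC _ _) (lmulmulC _ _)).
have bform : bilinear form.
  apply: bilinear_mean => u v; apply: bilinear_mean => p q.
  exact: (bilinear_precomp (lmulmid _ _) (lmulmid _ _)).
have form_mull k x y : G k -> form (k * x) (k * y) = form x y.
  move=> Gk; apply: eq_mean => u v.
  rewrite /inner -(mean_shiftr Gk (binner_pq x y u v)).
  by apply: eq_mean => p q; rewrite !mulrA.
have form_mulr k x y : G k -> form (x * k) (y * k) = form x y.
  move=> Gk; rewrite /form -(mean_shiftl Gk (binner x y)).
  by apply: eq_mean => u v; apply: eq_mean => p q; rewrite !mulrA.
exists form; split=> //.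
- move=> a x y.
  have l1 : linear (fun a => form (a * x) y).
    by move=> c u v; rewrite linE linE bform.1.
  have l2 : linear (fun a => form x (star a * y)).
    by move=> c u v; rewrite !linE bform.2.
  apply: (eq_linear_on_group Ggen l1 l2) => g; rewrite inE => Gg.
  by rewrite -[in RHS](form_mull g)// mulrA unitary_mul_star// mul1r.
- move=> a x y.
  have l1 : linear (fun a => form (x * a) y).
    by move=> c u v; rewrite linE linE bform.1.
  have l2 : linear (fun a => form x (y * star a)).
    by move=> c u v; rewrite !linE bform.2.
  apply: (eq_linear_on_group Ggen l1 l2) => g; rewrite inE => Gg.
  by rewrite -[in RHS](form_mulr g)// -mulrA unitary_star_mul// mulr1.
- move=> x x0; apply: (haar_moments_gt0 Hm (binner _ _) _) => g Gg.
  apply: (haar_moments_gt0 Hm (binner_pq _ _ _ _) _) => h Gh; apply: dot_gt0.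
  apply: contraNneq x0 => hxg0.
  by rewrite -[x]mul1r -(unitary_star_mul Gh) -[_ * x]mulr1
     -(unitary_mul_star Gg) -!mulrA (mulrA x) (mulrA h) (mulrA h) hxg0 mul0r mulr0.
Qed.

(** If [z + z * tau = 0], the cross terms in the mean of the squared norm of
    [phi g = g * star z + z * star g] cancel the two square terms, so this mean
    is zero.  To conclude that [phi] vanishes everywhere, and not only almost
    everywhere on [G], take [k_i] in [G] spanning the algebra: by invariance the
    sum of the squared norms of the [phi (k_i * g)] also has mean zero, whereas
    for a nonzero [phi] it is positive at every [g] in [G]. *)
Lemma one_plus_twisted_mean_regular z : z * (1 + tau) = 0 -> z = 0.
Proof.
rewrite mulrDr mulr1 -twisted_mean_mulr => /eqP; rewrite addrC addr_eq0 => /eqP cz.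
have [form [bform adjl adjr form_gt0]] := exists_invariant_form.
have [s sG s_full] := generates_span Ggen.
apply/eqP/negPn/negP => z0.
pose phi (g : A) := g * star z + z * star g.
have phi_lin : linear phi.
  by move=> c u v; rewrite /phi !linE scalerDr addrACA.
have formz : form z z = form (star z) (star z).
  transitivity (form 1 (z * star z)); first by rewrite -adjr mul1r.
  by rewrite -[z in z * _]starK -adjl mulr1.
have formzz : form (z * star z) 1 = form (star z) (star z).
  by rewrite adjl mulr1.
have formzz' : form 1 (z * star z) = form (star z) (star z).
  by rewrite -[z in z * _]starK -adjl mulr1.
have form_lin1 : linear (fun x => form (x * star z) 1).
  by move=> c u v; rewrite linE linE bform.1.
have form_lin2 : linear (fun x => form 1 (x * star z)).
  by move=> c u v; rewrite linE linE bform.2.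
have lstar : linear (fun u => z * star u) by move=> c u v; rewrite !linE.
have mean_sqr : mean m (fun u v => u * star z * v) = - z by rewrite -cz.
have phi_mean0 : mean m (fun u v => form (phi u) (phi v)) = 0.
  (* These are the four products of [u * star z] and [z * star u], where
     adjunction has turned the two mixed ones into linear functions of
     [u * star z * v], whose mean is [- z]. *)
  transitivity (mean m (fun u v => form (u * star z) (v * star z)) +
                mean m (fun u v => form (u * star z * v * star z) 1) +
                (mean m (fun u v => form 1 (u * star z * v * star z)) +
                mean m (fun u v => form (z * star u) (z * star v)))).
    rewrite -!meanD; apply: eq_mean => u v.
    have -> : form (u * star z * v * star z) 1 = form (u * star z) (z * star v).
      by rewrite -(mulrA _ v) adjr starM starK mul1r.
    have -> : form 1 (u * star z * v * star z) = form (z * star u) (v * star z).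
      by rewrite -[z * star u]mulr1 adjl starM !starK !mulrA.
    have formDl x y w : form (x + y) w = form x w + form y w.
      by have /= := bform.1 w 1 x y; rewrite !scale1r.
    have formDr x y w : form w (x + y) = form w x + form w y.
      by have /= := bform.2 w 1 x y; rewrite !scale1r.
    by rewrite /phi !formDl !formDr.
  rewrite -(linear_mean m (fun u v => u * star z * v) form_lin1) mean_sqr.
  rewrite -(linear_mean m (fun u v => u * star z * v) form_lin2) mean_sqr.
  rewrite (linear_opp _ form_lin1) (linear_opp _ form_lin2) formzz formzz'.
  rewrite (mean_cst (c := form (star z) (star z))).
  - rewrite (mean_cst (c := form (star z) (star z))).
    + by rewrite subrr addNr addr0.
    + exact: (bilinear_precomp lstar lstar bform).
    + by move=> g Gg; rewrite -adjr -mulrA unitary_star_mul// mulr1 formz.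
  - exact: (bilinear_precomp (linear_mulr _) (linear_mulr _) bform).
  - by move=> g Gg; rewrite adjl mulrA unitary_star_mul// mul1r.
have form_ge0 x : 0 <= (form x x : R).
  have [->|/form_gt0/ltW//] := eqVneq x 0.
  by rewrite (linear_at0 (bform.1 0)).
have phi_z : phi z != 0.
  have : 0 < (form z z : R) by exact: form_gt0.
  rewrite formz -formzz; apply: contraTneq => phiz0.
  have -> : z * star z = 2^-1 *: phi z.
    have -> : phi z = 2%:R *: (z * star z) by rewrite scaler_nat mulr2n.
    by rewrite scalerA mulVf ?scale1r// pnatr_eq0.
  by rewrite phiz0 scaler0 (linear_at0 (bform.1 1)) ltxx.
pose k (i : 'I_(size s)) := s`_i.
have kG i : G (k i) by apply/sG/mem_nth.
have lk i : linear (fun u => phi (k i * u)).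
  by move=> c u v; rewrite linE linE phi_lin.
have bk i : bilinear (fun u v => form (phi (k i * u)) (phi (k i * v))).
  exact: (bilinear_precomp (lk i) (lk i) bform).
have : 0 < (mean m (fun u v => \sum_i form (phi (k i * u)) (phi (k i * v))) : R).
  apply: (haar_moments_gt0 Hm).
    split=> w c u v /=; rewrite scaler_sumr -big_split; apply: eq_bigr => i _.
      exact: (bk i).1.
    exact: (bk i).2.
  move=> g Gg; rewrite lt_neqAle sumr_ge0 ?andbT//.
  apply: contraNneq phi_z => /esym/eqP; rewrite psumr_eq0// => /allP phi0.
  have lg : linear (fun x => phi (x * g)).
    by move=> c u v; rewrite linE linE phi_lin.
  have xs : z * star g \in span (in_tuple s) by rewrite s_full memvf.
  (* If all the [phi (k i * g)] vanish, so does [phi] at every multiple [x * g],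
     in particular at [z = (z * star g) * g]. *)
  rewrite -[z]mulr1 -(unitary_star_mul Gg) mulrA (coord_span xs) (linear_comb _ _ lg).
  rewrite big1// => i _; apply/eqP; rewrite scaler_eq0; apply/orP; right.
  have := phi0 i (mem_index_enum i); apply: contraTT => /form_gt0.
  by rewrite lt0r => /andP[].
rewrite mean_sum big1 ?ltxx// => i _.
exact: (etrans (mean_shiftl (kG i) (bilinear_precomp phi_lin phi_lin bform))).
Qed.

End Moments.
End Subgroup.

(** Both elements are the double mean of [g * h * g * h] over [g] in [G] and [h]
    in [G']. *)
Lemma twisted_mean1_unique (G G' : set A) (m m' : 'M[R]_(\dim {:A})) :
  unitary_subgroup star G -> haar_moments G m -> generates star G ->
  unitary_subgroup star G' -> haar_moments G' m' -> generates star G' ->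
  twisted_mean m 1 = twisted_mean m' 1.
Proof.
move=> G_sub Hm Ggen G_sub' Hm' Ggen'.
pose b (u v p q : A) := u * p * v * q.
transitivity (mean m' (fun p q => mean m (fun u v => b u v p q))); last first.
  rewrite mean_swap; apply: (mean_cst Hm).
    by apply: bilinear_mean => p q; split=> w c u v /=; rewrite /b !linE.
  move=> g Gg; transitivity (g * twisted_mean m' (star g)).
    rewrite (linear_mean _ _ (linear_mull _)); apply: eq_mean => p q.
    by rewrite starK /b !mulrA.
  by rewrite (twisted_mean_mulr G_sub' Hm' Ggen' (star g)) mulrA
    (unitary_mul_star G_sub)// mul1r.
apply/esym; apply: (mean_cst Hm').
  by apply: bilinear_mean => p q;
    split=> w c u v /=; rewrite /b !linE.
move=> h Gh; transitivity (twisted_mean m (star h) * h).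
  rewrite (linear_mean _ _ (linear_mulr _)); apply: eq_mean => p q.
  by rewrite starK.
by rewrite (twisted_mean_mull G_sub Hm Ggen (star h)) -mulrA
  (unitary_star_mul G_sub')// mulr1.
Qed.
End StarAlgebra.

(** * Topology and Borel structure of a finite-dimensional space *)

Section FiniteDimensionalTopology.
Variables (R : realType) (V : vectType R).

Lemma coordinates_continuous i :
  continuous (fun x : fdim_space V => coordinates (x : V) 0 i : R).
Proof.
move=> x.
have cx : {for x, continuous (@coordinates R V : fdim_space V -> 'rV[R]__)}.
  exact: initial_continuous.
exact: (continuous_comp cx (@coord_continuous _ _ _ 0 i _)).
Qed.

Lemma linear_fdim_continuous (W : normedModType R) (f : V -> W) :
  linear f -> continuous (f : fdim_space V -> W).
Proof.
move=> fl; have -> : f = fun x => \sum_i coordinates x 0 i *: f (vbasis {:V})`_i.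
  apply/funext => x; rewrite {1}(coord_vbasis (memvf x)) (linear_comb _ _ fl).
  by apply: eq_bigr => i _; rewrite mxE.
apply: continuous_big => [|i _ x]; first exact: add_continuous.
exact/continuousZr_tmp/coordinates_continuous.
Qed.

Lemma linear_fdim_endo_continuous (f : V -> V) :
  linear f -> continuous (f : fdim_space V -> fdim_space V).
Proof.
move=> fl; apply: continuous_comp_initial.
apply: (@linear_fdim_continuous _ (@coordinates R V \o f)) => c x y /=.
by rewrite fl; exact: passmx.rVof_linear.
Qed.

Lemma fdim_hausdorff : hausdorff_space (fdim_space V).
Proof.
move=> p q pq; apply: (can_inj (passmx.rVofK (vbasisP fullv))).
apply: norm_hausdorff => B C Bp Cq.
have [||x [Bx Cx]] := pq (@coordinates R V @^-1` B) (@coordinates R V @^-1` C).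
- exact: initial_continuous.
- exact: initial_continuous.
by exists (coordinates (x : V)).
Qed.

Lemma fdim_open_measurable (U : set (fdim_borel V)) :
  open (U : set (fdim_space V)) -> measurable U.
Proof. by move=> oU; exact: sub_sigma_algebra. Qed.

Lemma fdim_compact_measurable (G : set (fdim_borel V)) :
  compact (G : set (fdim_space V)) -> measurable G.
Proof.
move=> /(compact_closed fdim_hausdorff)/closed_openC/fdim_open_measurable.
by move=> /measurableC; rewrite setCK.
Qed.

Lemma fdim_continuous_measurable (f : fdim_borel V -> R) :
  continuous (f : fdim_space V -> R) -> measurable_fun setT f.
Proof.
move=> /continuousP cf; apply: (measurability _ (RGenOpens.measurableE R)).
move=> _ [_ [a [b ->] <-]]; rewrite setTI; apply: fdim_open_measurable.
exact/cf/interval_open.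
Qed.

Lemma linear_fdim_measurable (f : fdim_borel V -> fdim_borel V) :
  linear (f : V -> V) -> measurable_fun setT f.
Proof.
move=> /linear_fdim_endo_continuous/continuousP cf.
apply: (measurability (f := f) (D := setT) (@open (fdim_space V)) erefl).
move=> _ [U oU <-]; rewrite setTI; apply: sub_sigma_algebra; exact: cf.
Qed.

Lemma continuous_integrable_on_compact (mu : probability (fdim_borel V) R)
    (G : set (fdim_borel V)) (f : fdim_borel V -> R) :
  compact (G : set (fdim_space V)) -> continuous (f : fdim_space V -> R) ->
  mu.-integrable G (EFin \o f).
Proof.
move=> cG cf; apply: measurable_bounded_integrable.
- exact: fdim_compact_measurable.
- apply: (le_lt_trans (probability_le1 _ _) (ltry _)).
  exact: fdim_compact_measurable.
- have mf := fdim_continuous_measurable cf.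
  exact: (measurable_funTS mf).
- have := continuous_compact (continuous_subspaceT cf) cG.
  move=> /compact_bounded; rewrite /bounded_set /bounded_near => fG.
  near=> M => x Gx /=; have : forall y, (f @` G) y -> `|y| <= M by near: M.
  by apply; exists x.
Unshelve. all: by end_near. Qed.

(** Change of variables along a linear map preserving [G] and the measure on
    [G]. *)
Lemma Rintegral_linear_invariant (mu : probability (fdim_borel V) R)
    (G : set (fdim_borel V)) (phi : fdim_borel V -> fdim_borel V)
    (f : fdim_borel V -> R) :
  compact (G : set (fdim_space V)) -> linear (phi : V -> V) ->
  phi @^-1` G = G ->
  (forall B, measurable B -> B `<=` G -> mu (phi @^-1` B) = mu B) ->
  continuous (f : fdim_space V -> R) ->
  \int[mu]_(x in G) f (phi x) = \int[mu]_(x in G) f x.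
Proof.
move=> cG lphi phiG mu_phi cf.
have mphi := linear_fdim_measurable lphi.
have mf := (measurable_EFinP _ _).2 (fdim_continuous_measurable cf).
have cphi := linear_fdim_endo_continuous lphi.
have cfphi : continuous ((fun x => f (phi x)) : fdim_space V -> R).
  by move=> x; exact: (continuous_comp (cphi x) (cf _)).
transitivity (fine (\int[mu]_(x in phi @^-1` G) ((EFin \o f) \o phi) x)%E).
  by rewrite phiG.
rewrite -(integral_pushforward mphi mf); last 2 first.
- by rewrite phiG; exact: continuous_integrable_on_compact.
- exact: fdim_compact_measurable.
by congr fine; exact: eq_measure_integral.
Qed.
End FiniteDimensionalTopology.

(** * Moments of the Haar measure of a compact subgroup *)

Section MomentsOfHaar.
Variables (R : realType) (A : falgType R).
Variables (G : set A) (mu : probability (fdim_borel A) R).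
Hypothesis G_compact : compact (G : set (fdim_space A)).

Let mG : measurable (G : set (fdim_borel A)).
Proof. exact: fdim_compact_measurable. Qed.

Let integrable_on_G (f : A -> R) :
  continuous (f : fdim_space A -> R) ->
  mu.-integrable (G : set (fdim_borel A)) (EFin \o f).
Proof. exact: continuous_integrable_on_compact. Qed.

Let scalar_continuous (f : A -> R^o) :
  linear f -> continuous (f : fdim_space A -> R).
Proof. exact: (@linear_fdim_continuous _ _ R^o). Qed.

Let continuous_mul (f g : A -> R) :
  continuous (f : fdim_space A -> R) -> continuous (g : fdim_space A -> R) ->
  continuous ((fun x => f x * g x) : fdim_space A -> R).
Proof. by move=> cf cg x; exact: (continuousM (cf x) (cg x)). Qed.

Let continuous_cst (c : R) : continuous ((fun=> c) : fdim_space A -> R).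
Proof. by move=> x; exact: cst_continuous. Qed.

Lemma Rintegral_sum n (F : 'I_n -> A -> R) :
  (forall i, continuous (F i : fdim_space A -> R)) ->
  \int[mu]_(x in G) (\sum_i F i x) = \sum_i \int[mu]_(x in G) F i x.
Proof.
elim: n F => [|n IHn] F cF.
  under eq_Rintegral do rewrite big_ord0.
  by rewrite big_ord0 Rintegral_cst// mul0r.
under eq_Rintegral do rewrite big_ord_recl.
rewrite big_ord_recl RintegralD ?IHn//.
- exact: integrable_on_G.
- apply: integrable_on_G; apply: continuous_big => [|i _]; last exact: cF.
  exact: add_continuous.
Qed.

Definition moments : 'M[R]_(\dim {:A}) :=
  \matrix_(i, j) \int[mu]_(x in G)
    (coord (vbasis {:A}) i x * coord (vbasis {:A}) j x).

Let coordM_continuous i j c :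
  continuous ((fun x => coord (vbasis {:A}) i x * coord (vbasis {:A}) j x * c)
    : fdim_space A -> R).
Proof.
have cl k : continuous (coord (vbasis {:A}) k : fdim_space A -> R).
  by apply: scalar_continuous; exact: linearP.
exact: (continuous_mul (continuous_mul (cl i) (cl j)) (@continuous_cst c)).
Qed.

Let diagonalE (b : A -> A -> R^o) : bilinear b ->
  (fun x => b x x) = fun x => \sum_i \sum_j
    coord (vbasis {:A}) i x * coord (vbasis {:A}) j x *
    b (vbasis {:A})`_i (vbasis {:A})`_j.
Proof. by move=> bb; apply/funext => x; rewrite (bilinear_expand x x bb). Qed.

Lemma bilinear_continuous (b : A -> A -> R^o) : bilinear b ->
  continuous ((fun x => b x x) : fdim_space A -> R).
Proof.
move=> /diagonalE ->; apply: continuous_big => [|i _]; first exact: add_continuous.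
by apply: continuous_big => [|j _ //]; exact: add_continuous.
Qed.

Lemma mean_moments (b : A -> A -> R^o) : bilinear b ->
  mean moments b = \int[mu]_(x in G) (b x x : R).
Proof.
move=> /diagonalE bE; transitivity (\int[mu]_(x in G) (fun x => b x x) x) => //.
rewrite bE Rintegral_sum; last first.
  move=> i; apply: continuous_big => [|j _]; first exact: add_continuous.
  exact: coordM_continuous.
apply: eq_bigr => i _; rewrite Rintegral_sum; last first.
  by move=> j; exact: coordM_continuous.
apply: eq_bigr => j _; rewrite RintegralZr// ?mxE//.
have := @coordM_continuous i j 1; under eq_fun do rewrite mulr1.
exact: integrable_on_G.
Qed.

Lemma Rintegral_linear (f : A -> R^o) : linear f ->
  \int[mu]_(x in G) (f x : R) = f (fdim_integral mu G id).
Proof.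
move=> fl; rewrite /fdim_integral /passmx.vecof (linear_comb _ _ fl).
transitivity (\int[mu]_(x in G)
    \sum_i coord (vbasis {:A}) i x * (f (vbasis {:A})`_i : R)).
  apply: eq_Rintegral => x _.
  by rewrite {1}(coord_vbasis (memvf x)) (linear_comb _ _ fl).
have cl k : continuous (coord (vbasis {:A}) k : fdim_space A -> R).
  by apply: scalar_continuous; exact: linearP.
rewrite Rintegral_sum.
  apply: eq_bigr => i _; rewrite RintegralZr//; last exact: integrable_on_G.
  by rewrite mxE; congr (_ * _); apply: eq_Rintegral => x _; rewrite mxE.
by move=> i; exact: (continuous_mul (cl i) (@continuous_cst _)).
Qed.

(** Integrals of maps that are quadratic on [G] reduce to the barycentre of [G]
    and to its second moments. *)
Lemma fdim_integral_quadratic (F l : A -> A) (b : A -> A -> A) :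
  linear l -> bilinear b -> (forall g, G g -> F g = l g + b g g) ->
  fdim_integral mu G F = l (fdim_integral mu G id) + mean moments b.
Proof.
move=> ll bb FE; apply: (can_inj (passmx.rVofK (vbasisP fullv))).
rewrite {1}/fdim_integral passmx.vecofK ?vbasisP//; apply/rowP => j; rewrite !mxE.
have cl : linear (coord (vbasis {:A}) j : A -> R^o) by exact: linearP.
have cll : linear (fun x => coord (vbasis {:A}) j (l x) : R^o).
  by move=> c x y; rewrite ll linearP.
have cbb := bilinear_comp cl bb.
rewrite linearD /= (linear_mean _ _ cl) mean_moments//.
rewrite -(Rintegral_linear cll) -RintegralD//.
- by apply: eq_Rintegral => x; rewrite inE => /FE ->; rewrite mxE linearD.
- exact: (integrable_on_G (scalar_continuous cll)).
- exact: (integrable_on_G (bilinear_continuous cbb)).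
Qed.

Variables (star : A -> A).
Hypotheses (G_sub : unitary_subgroup star G) (G_haar : haar_probability G mu).

Let Rintegral_cstG (c : R) : \int[mu]_(x in G) c = c.
Proof.
have muG : fine (mu G) = 1 by rewrite G_haar.1.
by rewrite Rintegral_cst//; apply: (etrans (congr1 ( *%R c) muG)); rewrite mulr1.
Qed.

Lemma Rintegral_shiftl (f : A -> R) (k : A) :
  G k -> continuous (f : fdim_space A -> R) ->
  \int[mu]_(x in G) f (k * x) = \int[mu]_(x in G) f x.
Proof.
move=> Gk cf; have [GU _ GM GV] := G_sub.
have k_unit : k \is a GRing.unit.
  by apply/unitrP; exists (star k);
    rewrite (unitary_star_mul G_sub)// (unitary_mul_star G_sub).
apply: (Rintegral_linear_invariant G_compact (linear_mull k)) => // [|B mB BG].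
  apply/seteqP; split=> x /= Gx; last exact: GM.
  by rewrite -[x](mulKr k_unit); exact/GM/Gx/GV.
case: G_haar => _ mu_inv; rewrite -(mu_inv k^-1 B)//; last exact: GV.
congr (mu _); apply/seteqP; split=> x /=.
  by move=> Bx; exists (k * x); rewrite ?mulKr.
by move=> [y By <-]; rewrite mulVKr.
Qed.

(** Strict positivity uses compactness: a continuous function that is positive
    on [G] has a positive minimum there. *)
Lemma haar_moments_of_haar : haar_moments G moments.
Proof.
split=> [k b Gk bb|b c bb bc|b bb b_gt0].
- rewrite !mean_moments//; last first.
    exact: (bilinear_precomp (linear_mull k) (linear_mull k) bb).
  exact: (Rintegral_shiftl Gk (bilinear_continuous bb)).
- rewrite mean_moments//.
  rewrite (@eq_Rintegral _ _ _ _ _ (fun=> c : R)).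
    by rewrite Rintegral_cstG.
  by move=> x; rewrite inE => /bc.
- have [_ G1 _ _] := G_sub; have cb := bilinear_continuous bb.
  have G0 : (G : set (fdim_space A)) !=set0 by exists (1 : A).
  have [c Gc c_min] := compact_EVT_min G0 G_compact
    (continuous_subspaceT cb).
  rewrite mean_moments//; apply: (lt_le_trans (b_gt0 c _)); first exact/set_mem.
  apply: (@le_trans _ _ (\int[mu]_(x in G) (b c c : R))).
    by rewrite Rintegral_cstG.
  apply: le_Rintegral => //; first exact: (integrable_on_G (@continuous_cst _)).
    exact: integrable_on_G.
  by move=> x Gx; apply: c_min; rewrite inE.
Qed.
End MomentsOfHaar.

(** * The polarization identity *)

(** The term [Q x y] is kept as [Q x y * star g * g] in order to be quadratic in
    [g]. *)
Lemma hermitian_expansion (R : realType) (A : falgType R) (star : A -> A)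
    (G : set A) (X : lmodType A) (Q : X -> X -> A) (x y : X) (g : A) :
  involution star -> unitary_subgroup star G -> hermitian_form star Q -> G g ->
  Q (x + g *: y) (x + g *: y) * g =
  (Q x x * g + g * Q y y) + (Q x y * star g * g + g * star (Q x y) * g).
Proof.
move=> [star_lin starM starK] G_sub [QDl QZl Qstar] Gg.
have QDr u v w : Q w (u + v) = Q w u + Q w v.
  have starD a b : star (a + b) = star a + star b.
    by have := star_lin 1 a b; rewrite !scale1r.
  by rewrite -Qstar QDl starD !Qstar.
have QZr a u v : Q u (a *: v) = Q u v * star a.
  by rewrite -Qstar QZl starM Qstar.
rewrite QDl !QDr QZl !QZr QZl !mulrDl Qstar -!mulrA (unitary_star_mul G_sub Gg) !mulr1.
by rewrite [X in _ + X = _]addrC addrACA.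
Qed.

(** The centering of [G] kills the linear part; of the quadratic part, the first
    summand is constant on [G] and the second one has mean
    [twisted_mean (Q x y)]. *)
Lemma polarization_integral (R : realType) (A : falgType R) (star : A -> A)
    (G : set A) (mu : probability (fdim_borel A) R)
    (X : lmodType A) (Q : X -> X -> A) (x y : X) :
  involution star -> unitary_subgroup star G ->
  compact (G : set (fdim_space A)) -> haar_probability G mu ->
  generates star G -> fdim_integral mu G id = 0 -> hermitian_form star Q ->
  fdim_integral mu G (fun g => Q (x + g *: y) (x + g *: y) * g) =
  (1 + twisted_mean star (moments G mu) 1) * Q x y.
Proof.
move=> star_inv G_sub G_compact haar G_gen G_centered hermQ.
have Hm := haar_moments_of_haar G_compact G_sub haar.
have [star_lin _ _] := star_inv.
set a := Q x x; set b := Q y y; set q := Q x y.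
have lin_ab : linear (fun g => a * g + g * b).
  by move=> c u v; rewrite !mulrDl !mulrDr scale_mull scale_mulr scalerDr addrACA.
have bil1 : bilinear (fun u v => q * star u * v).
  split=> w c u v /=.
    by rewrite star_lin mulrDr mulrDl scale_mulr scale_mull.
  exact: linear_mull.
have bil2 : bilinear (fun u v => u * star q * v).
  split=> w c u v /=; last exact: linear_mull.
  by rewrite !mulrDl !scale_mull.
have bil : bilinear (fun u v => q * star u * v + u * star q * v).
  by split=> w c u v /=; rewrite ?(bil1.1, bil1.2, bil2.1, bil2.2) /= scalerDr addrACA.
rewrite (fdim_integral_quadratic mu G_compact lin_ab bil); last first.
  by move=> g Gg; exact: (hermitian_expansion _ _ star_inv G_sub hermQ Gg).
rewrite G_centered (linear_at0 lin_ab) add0r meanD mulrDl mul1r.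
rewrite -(twisted_mean_mull star_inv G_sub Hm G_gen); congr (_ + _).
by apply: (mean_cst Hm) => // g Gg; rewrite -mulrA (unitary_star_mul G_sub Gg) mulr1.
Qed.

Theorem theorem1p1 (R : realType) (A : falgType R) (star : A -> A)
    (star_inv : involution star) (A_pol : polarizable star) :
  exists kappa : A,
    forall (X : lmodType A) (Q : X -> X -> A), hermitian_form star Q ->
    forall (G : set A) (mu : probability (fdim_borel A) R),
      haar_probability G mu -> polarizing star G mu ->
    forall x y : X,
      Q x y = kappa * fdim_integral mu G
                        (fun g : A => Q (x + g *: y) (x + g *: y) * g).
Proof.
(* Any polarizing subgroup provides [kappa]; if there is none, the claim about
   [kappa] is void. *)
have [[G0 [mu0 [haar0 pol0]]]|none] := pselect (exists G0 mu0,
    @haar_probability R A G0 mu0 /\ polarizing star G0 mu0); last first.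
  by exists 0 => X Q _ G mu haar pol; case: none; exists G, mu.
have [G0_sub G0_compact G0_gen _] := pol0.
have Hm0 := haar_moments_of_haar G0_compact G0_sub haar0.
have [kappa kappaE] := regular_left_inverse
  (one_plus_twisted_mean_regular star_inv G0_sub Hm0 G0_gen).
exists kappa => X Q hermQ G mu haar [G_sub G_compact G_gen G_centered] x y.
have Hm := haar_moments_of_haar G_compact G_sub haar.
rewrite (polarization_integral _ _ star_inv G_sub G_compact haar G_gen G_centered
  hermQ).
by rewrite (twisted_mean1_unique star_inv G_sub Hm G_gen G0_sub Hm0 G0_gen) mulrA
  kappaE mul1r.
Qed.
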